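(* Let $n\ge 1$, let $H,L\in\mathbb{R}^{n\times n}$, $F\in\mathbb{R}^{n\times 1}$, let $\alpha\in\mathbb{R}$ and let $\lambda_1,\dots,\lambda_n\in\mathbb{R}$. Put $G=H+\alpha L$ and assume that the pair $(G,F)$ is completely controllable, i.e. the matrix $\begin{bmatrix}F & GF & \cdots & G^{n-1}F\end{bmatrix}$ is invertible. Define $a=\begin{bmatrix}a_{n-1}^* & \cdots & a_1^* & a_0^*\end{bmatrix}$ by $$\prod_{i=1}^n(\beta-\lambda_i)=\beta^n+a_{n-1}^*\beta^{n-1}+\cdots+a_1^*\beta+a_0^*,$$ and define $$b=-\begin{bmatrix}0&\cdots&0&1\end{bmatrix}\begin{bmatrix}F & GF & \cdots & G^{n-1}F\end{bmatrix}^{-1},\qquad D=\begin{bmatrix}(bG^{n-1})' & \cdots & (bG)' & b'\end{bmatrix}'.$$ Then with the gains $T_u=\alpha I$ and $T_v=aD+bG^n\in\mathbb{R}^{1\times n}$, the spectrum of the operator $$\mathcal{L}_c(X)=(H+LT_u+FT_v)X+X(H+LT_u+FT_v)'+T_uXT_u'$$ is the desired set: $$\sigma(\mathcal{L}_c)=\{\lambda_i+\lambda_j+\alpha^2:\ 1\le i\le j\le n\}.$$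
   Context: $A'$ denotes the transpose (without complex conjugation) of $A$, and $I$ is the $n\times n$ identity matrix. The operator $\mathcal{L}_c$ arises from the continuous-time stochastic system $dx(t)=[Hx(t)+Lu(t)+Fv(t)]dt+u(t)\,d\sigma(t)$, with state $x(t)\in\mathbb{R}^n$, controls $u(t)\in\mathbb{R}^n$ and $v(t)\in\mathbb{R}$, and $\sigma(t)$ a one-dimensional standard Brownian motion, under the state feedback $u(t)=T_ux(t)$, $v(t)=T_vx(t)$. The operator $\mathcal{L}_c$ acts on the space of $n\times n$ symmetric matrices $X$ ($X'=X$) with complex entries, and its spectrum is $$\sigma(\mathcal{L}_c)=\{\mu\in\mathbb{C}:\ \mathcal{L}_c(X)=\mu X\text{ for some symmetric } X\ne 0\}.$$ *)

(* Defs.v *)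
From mathcomp Require Export all_boot all_order all_algebra.
From mathcomp Require Export classical_sets reals complex.
Set Implicit Arguments.
Unset Strict Implicit.
Unset Printing Implicit Defensive.
Import Order.TTheory GRing.Theory Num.Theory.
Local Open Scope ring_scope.
Local Open Scope complex_scope.
Local Open Scope classical_set_scope.

Section Defs.
Variables (R : realType) (n : nat).

Definition controllability_mx (G : 'M[R]_n) (F : 'cV[R]_n) : 'M[R]_n :=
  \matrix_(i < n, k < n) (G ^+ k *m F) i ord0.

Definition completely_controllable (G : 'M[R]_n) (F : 'cV[R]_n) : Prop :=
  controllability_mx G F \in unitmx.

(* Column j (counted from 0) of a holds the coefficient of degree n - 1 - j of
   \prod_i (X - lambda_i); the leading coefficient 1 is left out. *)
Definition char_coefs (lambda : 'I_n -> R) : 'rV[R]_n :=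
  \row_(j < n) (\prod_(i < n) ('X - (lambda i)%:P))`_(n.-1 - j).

Definition last_unit_row : 'rV[R]_n := \row_(j < n) (j.+1 == n)%:R.

(* Equivalently b G^k F = 0 for k < n - 1 and b G^(n-1) F = -1, whence the sign
   of the feedback a D + b G^n. *)
Definition b_row (G : 'M[R]_n) (F : 'cV[R]_n) : 'rV[R]_n :=
  - (last_unit_row *m invmx (controllability_mx G F)).

Definition D_mx (G : 'M[R]_n) (F : 'cV[R]_n) : 'M[R]_n :=
  \matrix_(i < n) (b_row G F *m G ^+ (n.-1 - i)).

Definition toC m p (A : 'M[R]_(m, p)) : 'M[R[i]]_(m, p) :=
  map_mx (real_complex R) A.

(* Generator of the second moment E[x x'] of
     dx = [H x + L u + F v] dt + u dsigma,   u = Tu x,   v = Tv x;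
   ^T is the plain transpose, without complex conjugation. *)
Definition Lc (H L : 'M[R]_n) (F : 'cV[R]_n) (Tu : 'M[R]_n) (Tv : 'rV[R]_n)
    (X : 'M[R[i]]_n) : 'M[R[i]]_n :=
  let A := toC (H + L *m Tu + F *m Tv) in
  A *m X + X *m A^T + toC Tu *m X *m (toC Tu)^T.

(* Only symmetric (not Hermitian) complex matrices are admitted as
   eigenvectors. *)
Definition sym_spectrum (Op : 'M[R[i]]_n -> 'M[R[i]]_n) : set R[i] :=
  [set mu | exists X : 'M[R[i]]_n, [/\ X^T = X, X != 0 & Op X = mu *: X]].

End Defs.

(* Main.v *)
(** The sign of [b] makes [b G^k F = 0] for [k < n - 1] and [b G^(n-1) F = -1].
    With [A = G + F Tv] this gives [b A^k = b G^k] for [k < n] and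
    [b A^n = b G^n - Tv], so [b p(A) = b p(G) - Tv = 0], where [p] is the
    desired polynomial.  The rows [b A^k], [k < n], are independent, so a
    polynomial of degree less than [n] is determined by its value in [b q(A)];
    by Cayley-Hamilton [p] is the characteristic polynomial of [A].

    If [A X + X A^T = nu X], then [A X = X (nu - A^T)], hence
    [0 = p(A) X = X p(nu - A^T)]; for [X != 0] some [nu - lambda_i - A^T] is
    singular, so [nu - lambda_i] is an eigenvalue [lambda_j].  Conversely,
    eigenvectors [u], [w] of [A] yield the symmetric eigenvector
    [u w^T + w u^T], which is nonzero even when [u] and [w] are dependent. *)
Require Import Defs.
Import Order.TTheory GRing.Theory Num.Theory.
Local Open Scope ring_scope.
Local Open Scope complex_scope.
Local Open Scope classical_set_scope.

Set Implicit Arguments.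
Unset Strict Implicit.
Unset Printing Implicit Defensive.

(** * Spectrum of [X -> A X + X A^T] *)

Lemma char_poly_tr (R : comNzRingType) n (A : 'M[R]_n) :
  char_poly A^T = char_poly A.
Proof.
rewrite /char_poly -[RHS]det_tr; congr (\det _).
by rewrite /char_poly_mx linearB /= tr_scalar_mx map_trmx.
Qed.

Lemma intertwine_horner_mx (R : comNzRingType) n (A B X : 'M[R]_n.+1) p :
  A *m X = X *m B -> horner_mx A p *m X = X *m horner_mx B p.
Proof.
move=> AX; elim/poly_ind: p => [|p c IHp]; first by rewrite !rmorph0 mul0mx mulmx0.
rewrite !rmorphD !rmorphM /= !horner_mx_X !horner_mx_C mulmxDl mulmxDr.
by rewrite -scalar_mxC mulmxA -IHp -!mulmxA AX.
Qed.

Section Lyapunov.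

Variables (K : fieldType) (n : nat) (A : 'M[K]_n.+1) (lambda : 'I_n.+1 -> K).
Hypothesis char_polyA : char_poly A = \prod_i ('X - (lambda i)%:P).

Lemma eigenvalue_roots x : reflect (exists i, x = lambda i) (eigenvalue A x).
Proof.
rewrite eigenvalue_root_char char_polyA.
rewrite (_ : \prod_i _ = \prod_(y <- map lambda (enum 'I_n.+1)) ('X - y%:P)).
  rewrite root_prod_XsubC; apply: (iffP mapP) => [[i _ ->]|[i ->]]; first by exists i.
  by exists i => //; rewrite mem_enum.
by rewrite big_map big_enum.
Qed.

Lemma lyapunov_eigenvalue (X : 'M_n.+1) nu :
  X != 0 -> A *m X + X *m A^T = nu *: X -> exists i j, nu = lambda i + lambda j.
Proof.
move=> X0 eqX; pose B := nu%:M - A^T.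
have AX : A *m X = X *m B.
  by rewrite mulmxBr mul_mx_scalar -eqX addrK.
have := intertwine_horner_mx (char_poly A) AX.
rewrite Cayley_Hamilton mul0mx {1}char_polyA rmorph_prod /= => XB0.
(* [p(B)] is the product of the [B - lambda i]: either some factor is singular, or [p(B)] is
   invertible and [X p(B) = 0] forces [X = 0]. *)
have [/existsP[i Bi]|/existsPn Bunit] :=
    boolP [exists i, horner_mx B ('X - (lambda i)%:P) \isn't a GRing.unit].
  exists i; suff [j ljE] : exists j, nu - lambda i = lambda j.
    by exists j; rewrite -ljE addrC subrK.
  apply/eigenvalue_roots; rewrite eigenvalue_root_char -char_poly_tr.
  rewrite -eigenvalue_root_char; move: Bi.
  rewrite rmorphB /= horner_mx_X horner_mx_C /B addrAC -raddfB /=.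
  rewrite -[_ \is a _]/(_ \in unitmx) unitmxE unitfE negbK => /det0P[v v0].
  rewrite mulmxBr mul_mx_scalar => /eqP; rewrite subr_eq0 => /eqP vA.
  by apply/eigenvalueP; exists v.
case/eqP: X0; apply/(@mulIr _ (\prod_i horner_mx B ('X - (lambda i)%:P))).
  apply: (big_ind (fun M : 'M_n.+1 => M \is a GRing.unit)).
  - exact: unitr1.
  - by move=> M N uM uN; rewrite unitrMl.
  - by move=> i _; have := Bunit i; rewrite negbK.
by rewrite mul0r.
Qed.

Lemma lyapunov_eigenvector i j : 2%:R != 0 :> K ->
  exists X : 'M_n.+1, [/\ X^T = X, X != 0 &
    A *m X + X *m A^T = (lambda i + lambda j) *: X].
Proof.
move=> K2.
(* [eigenvalueP] yields row eigenvectors, so those of [A^T] are taken and transposed. *)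
have ev k : exists2 u : 'rV_n.+1, u *m A^T = lambda k *: u & u != 0.
  apply/eigenvalueP; rewrite eigenvalue_root_char char_poly_tr.
  by rewrite -eigenvalue_root_char; apply/eigenvalue_roots; exists k.
have evT (u : 'rV_n.+1) k : u *m A^T = lambda k *: u -> A *m u^T = lambda k *: u^T.
  by move=> /(congr1 trmx); rewrite trmx_mul trmxK linearZ.
have [u Au u0] := ev i; have [w Aw w0] := ev j.
exists (u^T *m w + w^T *m u); split.
- by rewrite linearD /= !trmx_mul !trmxK addrC.
- apply: contra_neq w0 => X0.
  have Xkl k l : u 0 k * w 0 l + w 0 k * u 0 l = 0.
    by have /matrixP/(_ k l) := X0; rewrite !mxE !big_ord1 !mxE.
  (* The diagonal entry [2 u_k w_k = 0] kills [w_k]; row [k] of [X] then kills all of [w]. *)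
  have [k uk] : exists k, u 0 k != 0 by apply/rV0Pn.
  have wk : w 0 k = 0.
    have /eqP := Xkl k k; rewrite [w 0 k * _]mulrC -mulr2n -mulr_natl.
    by rewrite !mulf_eq0 (negPf K2) (negPf uk) => /eqP.
  apply/rowP => l; rewrite mxE; have /eqP := Xkl k l.
  by rewrite wk mul0r addr0 mulf_eq0 (negPf uk) => /eqP.
- rewrite mulmxDr mulmxDl !mulmxA (evT u i Au) (evT w j Aw) -!mulmxA Au Aw.
  rewrite -!scalemxAl -!scalemxAr !scalerDl !scalerDr.
  by rewrite addrACA [X in _ + X]addrC addrACA [X in _ + X]addrC.
Qed.

End Lyapunov.

(** * Polynomials in a matrix applied to a row vector *)

Lemma size_monicB (R : nzRingType) n (p q : {poly R}) :
  p \is monic -> q \is monic -> size p = n.+1 -> size q = n.+1 ->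
  (size (p - q)%R <= n)%N.
Proof.
rewrite !monicE !lead_coefE => /eqP + /eqP + sp sq; rewrite sp sq /= => pn qn.
apply/leq_sizeP => k; rewrite leq_eqVlt coefB => /orP[/eqP <-|lt_nk].
  by rewrite pn qn subrr.
by rewrite !nth_default ?subr0 ?sp ?sq.
Qed.

(* The powers run downwards, as in [D_mx]. *)
Definition krylov_mx (K : fieldType) n (b : 'rV[K]_n.+1) (A : 'M[K]_n.+1) :=
  \matrix_(i < n.+1) (b *m A ^+ (n - i)).

(** Coefficients are listed from the highest degree down, the layout of [char_coefs] and [D_mx]. *)
Lemma row_horner_mx (K : fieldType) n (b : 'rV[K]_n.+1) (A : 'M[K]_n.+1)
    (q : {poly K}) :
  (size q <= n.+1)%N ->
  b *m horner_mx A q = (\row_j q`_(n - j)) *m krylov_mx b A.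
Proof.
move=> sq; rewrite [RHS]mulmx_sum_row (reindex_inj rev_ord_inj) /=.
have qE : q = \poly_(i < n.+1) q`_i.
  by apply/polyP => i; rewrite coef_poly; case: ltnP => // /(leq_trans sq)/leq_sizeP->.
rewrite {1}qE poly_def rmorph_sum mulmx_sumr; apply: eq_bigr => i _ /=.
rewrite horner_mxZ rmorphXn /= horner_mx_X rowK mxE /= subSS subKn ?leq_ord //.
by rewrite scalemxAr.
Qed.

(** With [A := G] and [p] the desired polynomial, the right-hand side is the prescribed gain [Tv],
    which is thus [b p(G)]. *)
Lemma row_horner_mx_monic (K : fieldType) n (b : 'rV[K]_n.+1)
    (A : 'M[K]_n.+1) (p : {poly K}) : p \is monic -> size p = n.+2 ->
  b *m horner_mx A p = (\row_j p`_(n - j)) *m krylov_mx b A + b *m A ^+ n.+1.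
Proof.
move=> mp sp; rewrite -[in LHS](subrK 'X^(n.+1) p) rmorphD mulmxDr.
rewrite row_horner_mx ?size_monicB ?monicXn ?size_polyXn //.
rewrite rmorphXn /= horner_mx_X; congr (_ *m _ + _); apply/rowP => j.
by rewrite !mxE coefB coefXn ltn_eqF ?subr0 // ltnS leq_subr.
Qed.

Lemma char_poly_cyclic (K : fieldType) n (b : 'rV[K]_n.+1) (A : 'M[K]_n.+1)
    (p : {poly K}) :
  krylov_mx b A \in unitmx -> p \is monic -> size p = n.+2 ->
  b *m horner_mx A p = 0 -> char_poly A = p.
Proof.
move=> uD mp sp bp; apply/eqP; rewrite -subr_eq0; apply/eqP.
set q := _ - p; have sq : (size q <= n.+1)%N.
  by rewrite size_monicB ?char_poly_monic ?size_char_poly.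
have /eqP : b *m horner_mx A q = 0.
  by rewrite rmorphB /= Cayley_Hamilton sub0r mulmxN bp oppr0.
rewrite row_horner_mx // mulmx_free_eq0 ?row_free_unit // => /eqP/rowP q0.
apply/polyP => k; rewrite coef0; have [lt_k|/(leq_sizeP _ _ sq)//] := ltnP k n.+1.
by have := q0 (inord (n - k)); rewrite !mxE inordK ?ltnS ?leq_subr // subKn.
Qed.

Section PolePlacement.

Variables (R : realType) (n : nat) (G : 'M[R]_n.+1) (F : 'cV[R]_n.+1).
Hypothesis ctrlGF : completely_controllable G F.
Let b := b_row G F.

Lemma b_row_powF k : (k <= n)%N -> b *m (G ^+ k *m F) = - (k == n)%:R%:M.
Proof.
move=> le_kn; apply/rowP => i; rewrite (ord1 i).
have /rowP/(_ (inord k)) : b *m controllability_mx G F = - last_unit_row _ _.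
  by rewrite /b /b_row mulNmx mulmxKV.
rewrite !mxE inordK ?ltnS // eqSS /= mulr1n => <-.
by apply: eq_bigr => j _; rewrite [controllability_mx _ _ _ _]mxE inordK.
Qed.

(** Entry [(i, j)] of the product with the controllability matrix is [b G^(n-i+j) F] when [j <= i]:
    zero below the diagonal and [-1] on it, so the product is triangular and invertible. *)
Lemma krylov_mx_unit : krylov_mx b G \in unitmx.
Proof.
have powF (i j : 'I_n.+1) : (j <= i)%N ->
    (krylov_mx b G *m controllability_mx G F) i j = - (i == j)%:R.
  move=> le_ji; have le_n : (n - i + j <= n)%N.
    by rewrite -[X in (_ <= X)%N](subnK (leq_ord i)) leq_add2l.
  have /rowP/(_ 0) := b_row_powF le_n.
  rewrite exprD -[_ * _]/(_ *m _) -!mulmxA mulmxA !mxE /= mulr1n.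
  rewrite -[X in (_ == X)%N](subnK (leq_ord i)) eqn_add2l eq_sym => <-.
  by apply: eq_bigr => k _; rewrite !mxE.
suff: krylov_mx b G *m controllability_mx G F \in unitmx.
  by rewrite unitmx_mul => /andP[].
move: (_ *m _) powF => M powF.
rewrite unitmxE -det_tr det_trig; last first.
  apply/is_trig_mxP => i j lt_ij; rewrite mxE powF; last exact: ltnW.
  by rewrite -val_eqE gtn_eqF ?oppr0.
rewrite (eq_bigr (fun=> -1)) => [|i _]; last by rewrite mxE powF // eqxx.
by rewrite prodr_const unitrX // unitrN unitr1.
Qed.

(** Ackermann's formula for pole placement. *)
Lemma char_poly_ackermann (p : {poly R}) : p \is monic -> size p = n.+2 ->
  char_poly (G + F *m (b *m horner_mx G p)) = p.
Proof.
move=> mp sp; set T := b *m _; set A := G + _.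
(* The feedback only adds terms [b G^k F T] with [k < n], which vanish. *)
have bA k : (k <= n)%N -> b *m A ^+ k = b *m G ^+ k.
  elim: k => [|k IHk] lt_kn; first by rewrite !expr0.
  rewrite !exprSr -[A ^+ k * A]/(_ *m _) mulmxA IHk ?(ltnW lt_kn) //.
  rewrite mulmxDr -!mulmxA (mulmxA _ F) (mulmxA b _ T).
  by rewrite b_row_powF ?(ltnW lt_kn) // ltn_eqF // raddf0 oppr0 mul0mx addr0.
have krylovA : krylov_mx b A = krylov_mx b G.
  by apply/row_matrixP => i; rewrite !rowK bA ?leq_subr.
apply: (@char_poly_cyclic _ _ b) => //; first by rewrite krylovA krylov_mx_unit.
(* One power further, [b G^n F = -1] subtracts exactly [T = b p(G)]. *)
rewrite row_horner_mx_monic // krylovA exprSr -[A ^+ n * A]/(_ *m _) mulmxA bA //.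
rewrite mulmxDr -!mulmxA (mulmxA _ F) (mulmxA b _ T).
rewrite b_row_powF // eqxx (mulNmx _ T) mul1mx -[G ^+ n *m G]exprSr addrA.
by rewrite -row_horner_mx_monic // subrr.
Qed.

End PolePlacement.

Theorem theorem3 (R : realType) (n : nat) (hn : (0 < n)%N)
    (H L : 'M[R]_n) (F : 'cV[R]_n) (alpha : R) (lambda : 'I_n -> R) :
  let G := H + alpha *: L in
  completely_controllable G F ->
  let a := char_coefs lambda in
  let b := b_row G F in
  let D := D_mx G F in
  let Tu : 'M[R]_n := alpha%:M in
  let Tv : 'rV[R]_n := a *m D + b *m G ^+ n in
  sym_spectrum (Lc H L F Tu Tv)
  = [set mu | exists i j : 'I_n,
       (i <= j)%N /\ mu = (lambda i + lambda j + alpha ^+ 2)%:C].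
Proof.
case: n hn H L F lambda => // n _ H L F lambda G ctrlGF a b D Tu Tv.
pose p := \prod_i ('X - (lambda i)%:P).
have mp : p \is monic by apply: monic_prod_XsubC.
have sp : size p = n.+2.
  by rewrite size_prod_XsubC /index_enum -enumT size_enum_ord.
(* Up to conversion, [a] is the coefficient row of [p] and [D] is [krylov_mx b G]. *)
have TvE : Tv = b *m horner_mx G p.
  by rewrite row_horner_mx_monic.
pose A := toC (H + L *m Tu + F *m Tv).
have char_polyA : char_poly A = \prod_i ('X - ((lambda i)%:C)%:P).
  rewrite /A /toC -map_char_poly mul_mx_scalar TvE.
  by rewrite char_poly_ackermann // map_prod_XsubC.
(* As [Tu] is scalar, the noise term is [alpha^2 X] and only shifts the spectrum. *)
have LcE X mu : Lc H L F Tu Tv X = mu *: X <->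
    A *m X + X *m A^T = (mu - (alpha ^+ 2)%:C) *: X.
  rewrite /Lc -/A /toC map_scalar_mx /= tr_scalar_mx mul_scalar_mx.
  rewrite mul_mx_scalar scalerA -rmorphM -expr2 scalerBl.
  by split=> [<-|->]; rewrite ?addrK ?subrK.
apply/seteqP; split=> mu /=.
  move=> [X [_ X0 /LcE /(lyapunov_eigenvalue char_polyA X0) [i [j]]]] /eqP.
  rewrite subr_eq => /eqP ->; rewrite -!rmorphD.
  have [le_ij|/ltnW le_ji] := leqP i j; first by exists i, j.
  by exists j, i; rewrite [lambda j + _]addrC.
move=> [i [j [_ ->]]].
have [|X [symX X0 AX]] := lyapunov_eigenvector char_polyA i j.
  by rewrite pnatr_eq0.
by exists X; split=> //; apply/LcE; rewrite AX -rmorphB /= addrK rmorphD.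
Qed.
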